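(* For all positive integers $t$ and $k$ with $2^t \mid k$, \[ g\left(n, k, \frac{3^{t-1}}{4^t}k^2 + \frac{3^{t-1}+1}{2}\right) = \Omega\left(n^{1 + \frac{1}{2^t - 1}}\right) \] as $n \to \infty$.
   Context: For a finite set $A \subseteq \mathbb{R}$, the difference set is $A - A = \{|a-b| : a, b \in A,\ a \neq b\}$ (only positive differences are counted). A set $A$ has the $(k,\ell)$-local property if every $k$-element subset $A' \subseteq A$ satisfies $|A' - A'| \geq \ell$. For integers $n \geq k \geq 1$ and real $\ell$, $g(n,k,\ell)$ is the minimum of $|A - A|$ over all $n$-element sets $A \subseteq \mathbb{R}$ with the $(k,\ell)$-local property, and $g(n,k,\ell) = +\infty$ if no such set exists. In asymptotic notation, $k$ and $t$ are fixed and $n \to \infty$. *)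

(* Defs.v *)
From mathcomp Require Import all_boot all_order all_algebra finmap.
From mathcomp Require Import all_classical all_reals all_analysis.

Set Implicit Arguments.
Unset Strict Implicit.
Unset Printing Implicit Defensive.

Import Order.TTheory GRing.Theory Num.Theory.

Local Open Scope classical_set_scope.
Local Open Scope ring_scope.

Definition diffset (R : realType) (A : {fset R}) : {fset R} :=
  [fset `|a - b| | a in A, b in A & a != b]%fset.

Definition local_property (R : realType) (k : nat) (l : R) (A : {fset R}) :
    Prop :=
  forall A' : {fset R}, (A' `<=` A)%fset -> #|` A'| = k ->
    l <= #|` diffset A'|%:R.

(* The infimum is over a set of natural numbers, so it is attained (a minimum)
   when the set is nonempty, and it is +oo when the set is empty.
   The value is meaningful for (1 <= k <= n)%N only. *)
Definition g (R : realType) (n k : nat) (l : R) : \bar R :=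
  ereal_inf [set (#|` diffset A|%:R)%:E | A in
    [set A : {fset R} | #|` A| = n /\ local_property k l A]].

(* u n = Omega(v n) as n -> oo, for nonnegative u and v; the Omega of the
   library's landau file does not apply to u, which may take the value +oo. *)
Definition ebigOmega (R : realType) (u : nat -> \bar R) (v : nat -> R) : Prop :=
  exists2 c : R, 0 < c & \forall n \near \oo, ((c * v n)%:E <= u n)%E.

(* Main.v *)
(* Write [t = u + 1] and [k = 2 ^ t * m]. A set with few differences has a
   popular difference [d_1]; passing to the [x] with [x] and [x + d_1] in the set
   and repeating [u] times, we obtain [B] and a cube [Q] of the [2 ^ u] subset
   sums of [d_1, ..., d_u] with [B + Q] contained in [A]. By additive energy some
   [s] has many representations [s = x + y] in [B]; picking [m] of these pairs
   gives a set [W], symmetric under [w |-> s - w], such that [W + Q] has exactly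
   [k] elements and at most [(2 m ^ 2 + 1) 3 ^ u] signed differences, too few for
   the local property. Quantitatively each step replaces [|B|] by a constant
   times [|B| ^ 2 / |A - A|], which leads to
   [|A| ^ (2 ^ t) <= O(|A - A| ^ (2 ^ t - 1))].

   Signed differences, zero included, are multiplicative under sumsets and number
   exactly [2 * #|diffset A| + 1], so they are used throughout. *)

Require Import Defs.
From mathcomp Require Import all_boot all_order all_algebra finmap.
From mathcomp Require Import zify ring lra.
From mathcomp Require Import all_classical all_reals all_analysis.
Import Order.TTheory GRing.Theory Num.Theory.
Local Open Scope ring_scope.

(** * Counting: images, products, fibers and pigeonhole *)

Lemma leq_card_image {T U : choiceType} (f : T -> U) (A : {fset T})
    (B : {fset U}) :
  (forall y, y \in B -> exists2 x, x \in A & y = f x) ->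
  (#|` B| <= #|` A|)%N.
Proof.
move=> BA; apply: (@leq_trans #|` [fset f x | x in A]%fset|);
  last exact: leq_imfset_card.
apply: fsubset_leq_card; apply/fsubsetP => y /BA[x xA ->].
by apply/imfsetP; exists x.
Qed.

Lemma leq_card_inj {T U : choiceType} (f : T -> U) (A : {fset T})
    (B : {fset U}) :
  {in A &, injective f} -> (forall x, x \in A -> f x \in B) ->
  (#|` A| <= #|` B|)%N.
Proof.
move=> inj_f fAB; rewrite -(card_in_imfset imfset_key inj_f).
by apply: fsubset_leq_card; apply/fsubsetP => y /imfsetP[x /= xA ->]; exact: fAB.
Qed.

Lemma card_fsetM {T U : choiceType} (A : {fset T}) (B : {fset U}) :
  #|` A `*` B|%fset = (#|` A| * #|` B|)%N.
Proof.
rewrite -(size_allpairs pair); apply/perm_size/uniq_perm.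
- exact: fset_uniq.
- by apply: allpairs_uniq => // -[? ?] [? ?].
- move=> [x y]; rewrite in_fsetM; apply/andP/allpairsP => [[xA yB]|].
    by exists (x, y).
  by case=> -[u v] [uA vB [-> ->]].
Qed.

Lemma card_fibers {T U : choiceType} (f : T -> U) (P : {fset T})
    (S : {fset U}) :
  (forall x, x \in P -> f x \in S) ->
  #|` P| = (\sum_(u <- S) #|` [fset x in P | f x == u]%fset|)%N.
Proof.
move=> fPS; rewrite card_fset_sum1.
have fib u : #|` [fset x in P | f x == u]%fset| = (\sum_(x <- P) (f x == u))%N.
  rewrite card_fset_sum1 big_fset /= [RHS]big_mkcond /=.
  rewrite [LHS]big_mkcond.
  by apply: eq_bigr => x _; case: (_ == _); rewrite ?inE.
under [RHS]eq_bigr do rewrite fib.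
rewrite exchange_big /=; apply: eq_big_seq => x xP.
rewrite (bigD1_seq (f x)) ?fset_uniq ?fPS //= eqxx big1 // => u.
by rewrite eq_sym => /negbTE ->.
Qed.

(** The popular value is given as [f x] with [x] in [P], so that what holds of all elements of [P]
    passes to it. *)
Lemma pigeonhole {T U : choiceType} (f : T -> U) (P : {fset T})
    (S : {fset U}) :
  (0 < #|` P|)%N -> (forall x, x \in P -> f x \in S) ->
  exists2 x, x \in P &
    (#|` P| <= #|` S| * #|` [fset y in P | f y == f x]%fset|)%N.
Proof.
move=> P_gt0 fPS; apply: contrapT => noP.
have small u : (#|` S| * #|` [fset y in P | f y == u]%fset| < #|` P|)%N.
  rewrite ltnNge; apply/negP => big; apply: noP.
  have [e|[x]] := fset_0Vmem [fset y in P | f y == u]%fset.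
    by move: big; rewrite e cardfs0 muln0 leqNgt P_gt0.
  by rewrite !inE /= => /andP[xP /eqP fxu]; exists x => //; rewrite fxu.
have [x xP] : exists x, x \in P by apply/fset0Pn; rewrite -cardfs_gt0.
have S_gt0 : (0 < #|` S|)%N.
  by rewrite cardfs_gt0; apply/fset0Pn; exists (f x); exact: fPS.
(* If all fibers were small, summing over [S] would give [#|S| * #|P| + #|S| <= #|S| * #|P|]. *)
have : (\sum_(u <- S) (#|` S| * #|` [fset y in P | f y == u]%fset|).+1
        <= \sum_(u <- S) #|` P|)%N by apply: leq_sum => u _; exact: small.
under eq_bigr do rewrite -addn1.
rewrite big_split /= -big_distrr /= -card_fibers // -card_fset_sum1.
rewrite big_const_seq count_predT iter_addn_0 mulnC.
by rewrite leqNgt -addn1 leq_add2l S_gt0.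
Qed.

(** * Signed differences and sumsets *)

Definition sdiff {V : zmodType} (A : {fset V}) : {fset V} :=
  [fset a - b | a in A, b in A]%fset.

Definition sumset {V : zmodType} (A B : {fset V}) : {fset V} :=
  [fset (a + b)%R | a in A, b in B]%fset.

Lemma sdiffP {V : zmodType} (A : {fset V}) d :
  reflect (exists x y, [/\ x \in A, y \in A & d = x - y]) (d \in sdiff A).
Proof.
apply: (iffP (imfset2P _ _ _ _ _)) => [[x xA [y yA ->]]|[x [y [xA yA ->]]]].
  by exists x, y.
by exists x => //; exists y.
Qed.

Lemma mem_sdiff {V : zmodType} (A : {fset V}) x y :
  x \in A -> y \in A -> x - y \in sdiff A.
Proof. by move=> xA yA; apply/sdiffP; exists x, y. Qed.

Lemma sumsetP {V : zmodType} (A B : {fset V}) z :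
  reflect (exists x y, [/\ x \in A, y \in B & z = x + y]) (z \in sumset A B).
Proof.
apply: (iffP (imfset2P _ _ _ _ _)) => [[x xA [y yA ->]]|[x [y [xA yA ->]]]].
  by exists x, y.
by exists x => //; exists y.
Qed.

Lemma mem_sumset {V : zmodType} (A B : {fset V}) x y :
  x \in A -> y \in B -> x + y \in sumset A B.
Proof. by move=> xA yA; apply/sumsetP; exists x, y. Qed.

Lemma sdiffN {V : zmodType} (A : {fset V}) d : d \in sdiff A -> - d \in sdiff A.
Proof. by move=> /sdiffP[x [y [xA yA ->]]]; rewrite opprB mem_sdiff. Qed.

Lemma sdiff0 {V : zmodType} (A : {fset V}) :
  (0 < #|` A|)%N -> 0 \in sdiff A.
Proof.
by rewrite cardfs_gt0 => /fset0Pn[x xA]; rewrite -(subrr x) mem_sdiff.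
Qed.

Lemma leq_card_sumset {V : zmodType} (A B : {fset V}) :
  (#|` sumset A B| <= #|` A| * #|` B|)%N.
Proof.
rewrite -card_fsetM; apply: (leq_card_image (fun p => p.1 + p.2)) => z.
by move=> /sumsetP[x [y [xA yB ->]]]; exists (x, y); rewrite // in_fsetM xA.
Qed.

(** From [x + q = y + r] follows [x - y = r - q], a difference of [Q]; separation thus makes the
    translates of [Q] disjoint. *)
Lemma card_sumset {V : zmodType} (W Q : {fset V}) :
  {in W &, forall x y, x - y \in sdiff Q -> x = y} ->
  #|` sumset W Q| = (#|` W| * #|` Q|)%N.
Proof.
move=> sepW; apply/eqP; rewrite eqn_leq leq_card_sumset -card_fsetM.
apply: (leq_card_inj (fun p => p.1 + p.2)) => [[x q] [y r]|[x q]].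
  rewrite !in_fsetM /= => /andP[xW qQ] /andP[yW rQ] /= e.
  have xy : x = y.
    apply: sepW => //; suff -> : x - y = r - q by exact: mem_sdiff.
    by apply/eqP; rewrite subr_eq addrAC (addrC r) -e addrK.
  by move: e; rewrite xy => /addrI ->.
by rewrite in_fsetM => /andP[xW qQ]; exact: mem_sumset.
Qed.

Lemma leq_card_sdiff_sumset {V : zmodType} (W Q : {fset V}) :
  (#|` sdiff (sumset W Q)| <= #|` sdiff W| * #|` sdiff Q|)%N.
Proof.
apply: leq_trans (leq_card_sumset _ _); apply: fsubset_leq_card.
apply/fsubsetP => z /sdiffP[a [b [/sumsetP[x [q [xW qQ ->]]]]]].
by move=> /sumsetP[y [r [yW rQ ->]]] ->; rewrite opprD addrACA mem_sumset ?mem_sdiff.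
Qed.

Lemma sdiff_subset {V : zmodType} (A B Q : {fset V}) :
  (0 < #|` Q|)%N -> (sumset B Q `<=` A)%fset -> (sdiff B `<=` sdiff A)%fset.
Proof.
rewrite cardfs_gt0 => /fset0Pn[q qQ] /fsubsetP BQA.
apply/fsubsetP => _ /sdiffP[x [y [xB yB ->]]].
have -> : x - y = (x + q) - (y + q) by rewrite opprD addrACA subrr addr0.
by apply: mem_sdiff; apply: BQA; exact: mem_sumset.
Qed.

Lemma leq_card_sdiff2 {V : zmodType} (d : V) :
  (#|` sdiff [fset 0%R; d]%fset| <= 3)%N.
Proof.
have sub : (sdiff [fset 0%R; d] `<=` [fset x in [:: 0%R; d; - d]])%fset.
  apply/fsubsetP => _ /sdiffP[x [y [xd yd ->]]]; move: xd yd.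
  rewrite !inE => /orP[]/eqP-> /orP[]/eqP->;
  by rewrite ?subr0 ?sub0r ?subrr !eqxx ?orbT.
apply: leq_trans (fsubset_leq_card sub) _.
by rewrite card_fseq; exact: leq_trans (size_undup _) _.
Qed.

(** As [d] is not a difference of [Q], the sets [Q] and [d + Q] are disjoint; the factor 3 counts
    [0], [d] and [- d]. *)
Lemma card_double {V : zmodType} (Q : {fset V}) d :
  (0 < #|` Q|)%N -> d \notin sdiff Q ->
  #|` sumset [fset 0%R; d]%fset Q| = (2 * #|` Q|)%N /\
  (#|` sdiff (sumset [fset 0%R; d]%fset Q)| <= 3 * #|` sdiff Q|)%N.
Proof.
move=> Q_gt0 dQ; have d0 : 0 != d.
  by apply: contraNneq dQ => <-; exact: sdiff0.
split; last first.
  apply: leq_trans (leq_card_sdiff_sumset _ _) _.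
  by rewrite leq_mul2r leq_card_sdiff2 orbT.
rewrite card_sumset ?cardfs2 ?d0 // => x y.
rewrite !inE => /orP[]/eqP-> /orP[]/eqP-> //; rewrite ?sub0r ?subr0 => dQ'.
  by move: dQ; rewrite -(opprK d) (sdiffN _ _ dQ').
by move: dQ; rewrite dQ'.
Qed.

(** Negation swaps positive and negative differences, and [diffset] keeps the positive ones; the
    extra one is [0]. *)
Lemma card_sdiff {R : realType} (A : {fset R}) :
  (0 < #|` A|)%N -> #|` sdiff A| = (2 * #|` diffset A|).+1.
Proof.
move=> A_gt0.
have diffP d : (d \in diffset A) = (0 < d) && (d \in sdiff A).
  apply/imfset2P/andP => [[a /= aA [b /= + ->]]|[d_gt0 /sdiffP[a [b [aA bA dab]]]]].
    rewrite !inE /= => /andP[bA ab]; rewrite normr_gt0 subr_eq0 ab; split=> //.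
    by case: (ger0P (a - b)) => _; rewrite ?opprB mem_sdiff.
  exists a => //; exists b; last by rewrite -dab gtr0_norm.
  by rewrite !inE bA /=; apply: contraTneq d_gt0 => ab; rewrite dab ab subrr ltxx.
have -> : sdiff A = (0%R |` (diffset A `|` [fset - d | d in diffset A]))%fset.
  apply/fsetP => d; rewrite !inE diffP.
  have -> : (d \in [fset - d | d in diffset A]%fset) = (d < 0) && (d \in sdiff A).
    apply/imfsetP/andP => [[e /= + ->]|[d_lt0 dA]].
      by rewrite diffP oppr_lt0 => /andP[-> /sdiffN].
    by exists (- d); rewrite ?opprK //= diffP oppr_gt0 d_lt0 sdiffN.
  rewrite -andb_orl orbC -neq_lt.
  by case: eqVneq => [<-|_]; rewrite ?orbT ?orbF ?sdiff0.
have posD d : d \in diffset A -> 0 < d by rewrite diffP => /andP[].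
have negD d : d \in [fset - d | d in diffset A]%fset -> d < 0.
  by move=> /imfsetP[e /= /posD e_gt0 ->]; rewrite oppr_lt0.
rewrite cardfsU1 cardfsU card_imfset /=; last exact: oppr_inj.
set I := (_ `&` _)%fset; have -> : I = fset0.
  apply/eqP/fset0Pn => -[d]; rewrite in_fsetI => /andP[/posD d_gt0 /negD].
  by rewrite ltNge ltW.
rewrite cardfs0 subn0 addnn -mul2n; case: (boolP (0 \in _)) => [|_ //].
by rewrite in_fsetU => /orP[/posD|/negD]; rewrite ltxx.
Qed.

(** * Popular differences and popular sums *)

Lemma popular_difference {V : zmodType} (B D S : {fset V}) :
  (0 < #|` B|)%N -> (2 * #|` D| <= #|` B|)%N -> (sdiff B `<=` S)%fset ->
  exists2 d, d \notin D &
    (#|` B| ^ 2 <= 2 * #|` S| * #|` [fset x in B | (x + d)%R \in B]%fset|)%N.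
Proof.
move=> B_gt0 DB /fsubsetP BS.
pose P := [fset p in (B `*` B)%fset | p.2 - p.1 \notin D]%fset.
pose N := [fset p in (B `*` B)%fset | p.2 - p.1 \in D]%fset.
have cBB : (#|` B| ^ 2 <= #|` P| + #|` N|)%N.
  rewrite -mulnn -card_fsetM -cardfsUI.
  apply: leq_trans (leq_addr _ _); apply/fsubset_leq_card/fsubsetP => p pBB.
  by move: pBB; rewrite !inE /= => /andP[-> ->]; rewrite /= orNb.
have cN : (#|` N| <= #|` B| * #|` D|)%N.
  rewrite -card_fsetM; apply: (leq_card_inj (fun p => (p.1, p.2 - p.1))).
    by move=> [x y] [x' y'] _ _ /= [-> /addIr ->].
  by move=> [x y]; rewrite !inE /= => /andP[/andP[xB _] yD]; rewrite xB yD.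
(* Since [2 * #|D| <= #|B|], at most half of the pairs have their difference in [D]. *)
have P_ge : (#|` B| ^ 2 <= 2 * #|` P|)%N by nia.
have P_gt0 : (0 < #|` P|)%N by nia.
have [|q qP hq] := pigeonhole (fun p : V * V => p.2 - p.1) P S P_gt0.
  move=> p; rewrite !inE /= => /andP[/andP[p1 p2] _].
  by apply: BS; exact: mem_sdiff.
exists (q.2 - q.1); first by move: qP; rewrite !inE => /andP[].
rewrite -mulnA; apply: (leq_trans P_ge); rewrite leq_pmul2l //.
apply: (leq_trans hq); rewrite leq_mul2l; apply/orP; right.
apply: (leq_card_inj fst) => [[x y] [x' y']|[x y]]; rewrite !inE /=.
  move=> /andP[_ /eqP e] /andP[_ /eqP e'] xx'; move: e e'; rewrite xx' => <-.
  by move=> /addIr ->.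
move=> /andP[/andP[/andP[xB yB] _] /eqP <-].
by rewrite xB addrC subrK yB.
Qed.

(** Cauchy-Schwarz, by summing [2 * f i * f j <= f i ^ 2 + f j ^ 2] over all pairs. *)
Lemma sqr_sum_leq (I : Type) (s : seq I) (f : I -> nat) :
  ((\sum_(i <- s) f i) ^ 2 <= size s * \sum_(i <- s) f i ^ 2)%N.
Proof.
rewrite -(leq_pmul2l (isT : (0 < 2)%N)) -mulnn big_distrlr /= big_distrr /=.
apply: (@leq_trans (\sum_(i <- s) \sum_(j <- s) (f i ^ 2 + f j ^ 2))%N).
  apply: leq_sum => i _; rewrite big_distrr; apply: leq_sum => j _.
  exact: nat_Cauchy.
under eq_bigr do rewrite big_split /= big_const_seq count_predT iter_addn_0.
rewrite big_split /= -big_distrl big_const_seq count_predT iter_addn_0 /=.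
lia.
Qed.

(* Both sides of the double count are the additive energy of [B]: grouping the
   solutions of [x - y = z - w] by the common difference bounds it from below,
   grouping them by [(x, w)], where [y + z = x + w], bounds it from above. *)
Lemma popular_sum {V : zmodType} (B : {fset V}) (M : nat) :
  (0 < #|` B|)%N ->
  (forall s, #|` [fset x in B | (s - x)%R \in B]%fset| <= M)%N ->
  (#|` B| ^ 2 <= #|` sdiff B| * M)%N.
Proof.
move=> B_gt0 rM.
pose BB := (B `*` B)%fset.
pose dif (p : V * V) := p.1 - p.2.
pose F d := [fset p in BB | dif p == d]%fset.
pose E := [fset u in (BB `*` BB)%fset | dif u.1 == dif u.2]%fset.
have difB p : p \in BB -> dif p \in sdiff B.
  by rewrite in_fsetM => /andP[p1 p2]; exact: mem_sdiff.
have cBB : (#|` B| ^ 2)%N = (\sum_(d <- sdiff B) #|` F d|)%N.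
  by rewrite -mulnn -card_fsetM; exact: card_fibers.
have cE : #|` E| = (\sum_(d <- sdiff B) #|` F d| ^ 2)%N.
  rewrite (@card_fibers _ _ (fun u => dif u.1) E (sdiff B)); last first.
    by move=> u; rewrite !inE /= => /andP[/andP[/andP[? ?] _] _]; exact: mem_sdiff.
  apply: eq_bigr => d _; rewrite -mulnn -card_fsetM.
  congr (size (enum_fset _)); apply/fsetP => u.
  rewrite !inE /=; case: (eqVneq (dif u.1) d) => [->|_].
    by rewrite !andbT eq_sym -!andbA.
  by rewrite !andbF.
have leE : (#|` E| <= #|` B| ^ 2 * M)%N.
  rewrite (@card_fibers _ _ (fun u => (u.1.1, u.2.2)) E BB); last first.
    move=> [[x y] [z w]]; rewrite !inE /=.
    by move=> /andP[/andP[/andP[-> _] /andP[_ ->]] _].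
  apply: (@leq_trans (\sum_(p <- BB) M)%N); last first.
    by rewrite big_const_seq count_predT iter_addn_0 mulnC -mulnn -card_fsetM.
  apply: leq_sum => -[a b] _; apply: leq_trans (rM (a + b)).
  apply: (leq_card_inj (fun u => u.1.2)) => [[[x y] [z w]] [[x' y'] [z' w']]|].
    rewrite !inE /dif /= => /andP[/andP[_ /eqP e] /eqP[xa wb]].
    move=> /andP[/andP[_ /eqP e'] /eqP[xa' wb']] yy.
    have -> : z = z' by rewrite -(subrK w z) -e xa wb yy -wb' -xa' e' subrK.
    by rewrite xa wb xa' wb' yy.
  move=> [[x y] [z w]]; rewrite !inE /dif /=.
  move=> /andP[/andP[/andP[/andP[_ yB] /andP[zB _]] /eqP e] /eqP[<- <-]].
  have -> : x + w - y = z by rewrite addrAC e subrK.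
  by rewrite yB zB.
have S_gt0 : (0 < #|` sdiff B|)%N.
  by rewrite cardfs_gt0; apply/fset0Pn; exists 0; exact: sdiff0.
(* Cauchy-Schwarz yields [#|B| ^ 4 <= #|sdiff B| * #|E|]; after the upper bound on [E], a factor
   [#|B| ^ 2] cancels. *)
have := sqr_sum_leq _ (sdiff B) (fun d => #|` F d|).
rewrite -cBB -cE => /leq_trans-/(_ (#|` sdiff B| * (#|` B| ^ 2 * M)))%N.
rewrite leq_mul2l leE orbT => /(_ isT).
by rewrite -mulnn mulnCA leq_pmul2l ?expn_gt0 ?B_gt0.
Qed.

(** * Separated sets symmetric under a reflection *)

Lemma leq_card_fsetU {T : choiceType} (A B : {fset T}) :
  (#|` (A `|` B)%fset| <= #|` A| + #|` B|)%N.
Proof. by rewrite -cardfsUI leq_addr. Qed.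

Lemma exists_notin {T : choiceType} (A B : {fset T}) :
  (#|` B| < #|` A|)%N -> exists2 x, x \in A & x \notin B.
Proof.
move=> BA; have /fsubsetPn : ~~ (A `<=` B)%fset.
  by apply: contraTN BA => /fsubset_leq_card; rewrite -leqNgt.
by case=> x xA xB; exists x.
Qed.

(* Greedy choice: a new element [x] is only barred from three families of at
   most [n * #|D|], [n * #|D|] and [#|D|] values, the last one ([x + x - s] in
   [D]) because [x] must also be separated from its own reflection. *)
Lemma separated_subset {F : numFieldType} (C D : {fset F}) (s : F) (n : nat) :
  0 \in D -> (forall d, d \in D -> - d \in D) ->
  (2 * n * #|` D| < #|` C|)%N ->
  exists X : {fset F}, [/\ (X `<=` C)%fset, #|` X| = n,
    {in X &, forall x y, x - y \in D -> x = y} &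
    {in X &, forall x y, x + y - s \notin D}].
Proof.
move=> D0 DN; elim: n => [|n IHn] hC.
  by exists fset0; split=> // [|x|x]; rewrite ?fsub0set ?cardfs0 ?inE.
have [|X [XC cX sepX symX]] := IHn; first by apply: leq_ltn_trans hC; nia.
pose H := [fset ((s + d) / 2%:R)%R | d in D]%fset.
pose N := (sumset X D `|` sumset [fset (s - x)%R | x in X] D `|` H)%fset.
have cN : (#|` N| < #|` C|)%N.
  have le1 := leq_card_sumset X D; rewrite cX in le1.
  have leX : (#|` [fset (s - x)%R | x in X]%fset| <= n)%N.
    by rewrite -cX; exact: leq_imfset_card.
  have le2 := leq_trans (leq_card_sumset [fset (s - x)%R | x in X]%fset D)
    (leq_mul leX (leqnn _)).
  have leH : (#|` H| <= #|` D|)%N by exact: leq_imfset_card.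
  apply: leq_ltn_trans (leq_card_fsetU _ _) _.
  have := leq_card_fsetU (sumset X D) (sumset [fset (s - x)%R | x in X]%fset D).
  move=> /leq_trans/(_ (leq_add le1 le2)) le12.
  (* The barred values number at most [(2 * n + 1) * #|D|], within the allowance
     [2 * n.+1 * #|D|]. *)
  apply: leq_ltn_trans (leq_add le12 leH) (leq_ltn_trans _ hC).
  by move: #|` D| => d; nia.
have [x xC xN] := exists_notin _ _ cN.
move: xN; rewrite !in_fsetU !negb_or => /andP[/andP[xX xsX] xH].
have far y : y \in X -> x - y \notin D.
  move=> yX; apply: contraNN xX => xyD.
  by rewrite -(subrK y x) addrC mem_sumset.
have far' y : y \in X -> x + y - s \notin D.
  move=> yX; apply: contraNN xsX => xyD.
  have -> : x = (s - y) + (x + y - s) by ring.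
  by apply: mem_sumset => //; apply/imfsetP; exists y.
have farx : x + x - s \notin D.
  apply: contraNN xH => xxD; apply/imfsetP; exists (x + x - s) => //.
  by field.
exists (x |` X)%fset; split.
- by rewrite fsubUset fsub1set xC.
- rewrite cardfsU1 cX; case: (boolP (x \in X)) => // /far.
  by rewrite subrr D0.
- move=> y z; rewrite !inE => /orP[/eqP->|yX] /orP[/eqP->|zX] //.
  + by move=> xzD; have := far z zX; rewrite xzD.
  + by move=> /DN; rewrite opprB => xyD; have := far y yX; rewrite xyD.
  + exact: sepX.
- move=> y z; rewrite !inE => /orP[/eqP->|yX] /orP[/eqP->|zX] //.
  + exact: far'.
  + by rewrite (addrC y); exact: far'.
  + exact: symX.
Qed.

Lemma mem_reflect {V : zmodType} (X : {fset V}) (s w : V) :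
  w \in (X `|` [fset (s - x)%R | x in X])%fset ->
  exists2 x, x \in X & w = x \/ w = s - x.
Proof.
rewrite in_fsetU => /orP[wX|/imfsetP[x /= xX ->]]; first by exists w; [|left].
by exists x; [|right].
Qed.

(* The differences of [X] and its reflection [s - X] are [0], the [x - y] with
   [x != y], and the [+-(x + y - s)]; letting [(x, y, sign)] index the former
   two ways according to [x <= y] or [y < x] gives the exact count. *)
Lemma leq_card_sdiff_reflect {R : realDomainType} (X : {fset R}) (s : R) :
  (#|` sdiff (X `|` [fset (s - x)%R | x in X])%fset|
    <= (2 * #|` X| ^ 2).+1)%N.
Proof.
set W := (X `|` _)%fset.
pose h (u : R * R * bool) := (-1) ^+ u.2 *
  (if u.1.1 <= u.1.2 then u.1.1 + u.1.2 - s else u.1.1 - u.1.2).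
pose I := ((X `*` X) `*` [fset true; false])%fset.
have cI : #|` I| = (2 * #|` X| ^ 2)%N.
  by rewrite !card_fsetM cardfs2 /= mulnC mulnn.
rewrite -cI.
pose J := (0%R |` [fset h u | u in I])%fset.
have cJ : (#|` J| <= #|` I|.+1)%N.
  rewrite cardfsU1; apply: (@leq_trans (1 + #|` I|)%N) => //.
  by apply: leq_add; [exact: leq_b1 | exact: leq_imfset_card].
apply: leq_trans cJ; apply: fsubset_leq_card.
have sumJ x y (b : bool) : x \in X -> y \in X -> (-1) ^+ b * (x + y - s) \in J.
  (* The sum is symmetric in [x] and [y], so the pair can be ordered to fall in the branch of [h]
     reserved for sums. *)
  wlog xy : x y / x <= y => [wl|] xX yX.
    by case/orP: (le_total x y) => xy; last rewrite (addrC x); exact: wl.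
  rewrite in_fsetU; apply/orP; right; apply/imfsetP; exists (x, y, b) => /=.
    by rewrite !inE /= xX yX; case: b.
  by rewrite /h /= xy.
have subJ x y : x \in X -> y \in X -> x - y \in J.
  move=> xX yX; rewrite in_fsetU.
  case: (ltgtP x y) => [xy|yx|->]; last by rewrite subrr !inE eqxx.
    apply/orP; right; apply/imfsetP; exists (y, x, true) => /=.
      by rewrite !inE /= xX yX.
    by rewrite /h /= leNgt xy /= expr1 mulN1r opprB.
  apply/orP; right; apply/imfsetP; exists (x, y, false) => /=.
    by rewrite !inE /= xX yX.
  by rewrite /h /= leNgt yx /= expr0 mul1r.
have WP := @mem_reflect _ X s.
apply/fsubsetP => _ /sdiffP[_ [_ [/WP[x xX [->|->]] /WP[y yX [->|->]] ->]]].
- exact: subJ.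
- have -> : x - (s - y) = (-1) ^+ false * (x + y - s) by rewrite /=; ring.
  exact: sumJ.
- have -> : s - x - y = (-1) ^+ true * (x + y - s) by rewrite /=; ring.
  exact: sumJ.
- have -> : s - x - (s - y) = y - x by ring.
  exact: subJ.
Qed.

(** The set is [W + Q] with [W] the union of [X] and [s - X]. The symmetry of [W] makes differences
    coincide: about [2 * m ^ 2] of them, where a generic set of [2 * m] elements has about
    [4 * m ^ 2]. *)
Lemma symmetric_configuration {R : realFieldType} (B Q : {fset R}) (m : nat)
    (s : R) :
  (0 < #|` Q|)%N ->
  (2 * m * #|` sdiff Q| < #|` [fset x in B | (s - x)%R \in B]%fset|)%N ->
  exists A' : {fset R}, [/\ (A' `<=` sumset B Q)%fset,
    #|` A'| = (2 * m * #|` Q|)%N &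
    (#|` sdiff A'| <= (2 * m ^ 2).+1 * #|` sdiff Q|)%N].
Proof.
move=> Q_gt0 hC; have D0 := sdiff0 _ Q_gt0.
have [X [/fsubsetP XC cX sepX symX]] :=
  separated_subset _ _ s m D0 (sdiffN Q) hC.
pose W := (X `|` [fset (s - x)%R | x in X])%fset.
have WP := @mem_reflect _ X s.
have WB w : w \in W -> w \in B.
  by move=> /WP[x /XC + [->|->]]; rewrite !inE => /andP[].
have cW : #|` W| = (2 * m)%N.
  rewrite cardfsU card_imfset /=; last by move=> x y /addrI/oppr_inj.
  (* A common element [x = s - y] would give [x + y - s = 0], a difference of [Q]; the case [x = y]
     is covered too. *)
  set I := (_ `&` _)%fset; have -> : I = fset0.
    apply/eqP/fset0Pn => -[x]; rewrite in_fsetI => /andP[xX /imfsetP[y /= yX xy]].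
    by have := symX x y xX yX; rewrite {1}xy subrK subrr D0.
  by rewrite cX cardfs0 subn0 addnn mul2n.
have sepW : {in W &, forall x y, x - y \in sdiff Q -> x = y}.
  move=> _ _ /WP[x xX [->|->]] /WP[y yX [->|->]].
  - exact: sepX.
  - by rewrite opprB addrA (negbTE (symX x y xX yX)).
  - move=> /sdiffN; have -> : - (s - x - y) = x + y - s by ring.
    by rewrite (negbTE (symX x y xX yX)).
  - have -> : s - x - (s - y) = y - x by ring.
    by move=> /sepX ->.
exists (sumset W Q); split.
- apply/fsubsetP => _ /sumsetP[w [q [wW qQ ->]]].
  by apply: mem_sumset => //; exact: WB.
- by rewrite card_sumset // cW.
- apply: leq_trans (leq_card_sdiff_sumset _ _) _.
  by rewrite leq_mul2r -cX leq_card_sdiff_reflect orbT.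
Qed.

(** * The doubling recursion *)

(* [2 ^ u.+1 * m] is [k], and the bound on [sdiff A'], of odd cardinal
   [2 * #|diffset A'| + 1], is the required number of differences. *)
Definition no_configuration {V : zmodType} (u m : nat) (A : {fset V}) : Prop :=
  forall A' : {fset V}, (A' `<=` A)%fset -> #|` A'| = (2 ^ u.+1 * m)%N ->
  ((2 * m ^ 2).+1 * 3 ^ u < #|` sdiff A'|)%N.

(* [i] counts the doublings of [Q] still to be made; a set [B] too small to
   double (size at most [2 * 3 ^ u]) satisfies the bound trivially. *)
Lemma cube_recursion {R : realFieldType} (u m i : nat) :
  exists K, forall (A B Q : {fset R}) (j : nat), (i + j = u)%N ->
    #|` Q| = (2 ^ j)%N -> (#|` sdiff Q| <= 3 ^ j)%N ->
    (sumset B Q `<=` A)%fset -> no_configuration u m A ->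
    (#|` B| ^ (2 ^ i.+1) <= K * #|` sdiff A| ^ (2 ^ i.+1).-1)%N.
Proof.
elim: i => [|i [K IHK]].
  (* A sum with more than [2 * m * 3 ^ u] representations would produce a forbidden
     configuration. *)
  exists (2 * m * 3 ^ u)%N => A B Q j; rewrite add0n => -> cQ sQ BQA noA.
  have Q_gt0 : (0 < #|` Q|)%N by rewrite cQ expn_gt0.
  have [B0|B_gt0] := posnP #|` B|; first by rewrite B0.
  rewrite expn1 /= expn1 mulnC.
  apply: leq_trans (leq_mul (fsubset_leq_card (sdiff_subset _ _ _ Q_gt0 BQA))
    (leqnn _)).
  apply: popular_sum => // s; rewrite leqNgt; apply/negP => hC.
  have [|A' [A'BQ cA' sA']] := symmetric_configuration B Q m s Q_gt0.
    by apply: leq_ltn_trans hC; rewrite leq_mul2l sQ orbT.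
  have := noA A' (fsubset_trans A'BQ BQA).
  rewrite cA' cQ expnS mulnAC => /(_ erefl); rewrite ltnNge => /negP[].
  by apply: leq_trans sA' _; rewrite leq_mul2l sQ orbT.
(* The first summand pays for a small [B], the second for a doubling step. *)
exists ((2 * 3 ^ u) ^ (2 ^ i.+2) + 2 ^ (2 ^ i.+1) * K)%N => A B Q j.
rewrite addSnnS => iju cQ sQ BQA noA.
have Q_gt0 : (0 < #|` Q|)%N by rewrite cQ expn_gt0.
have [B0|B_gt0] := posnP #|` B|; first by rewrite B0 exp0n // expn_gt0.
have BA := sdiff_subset _ _ _ Q_gt0 BQA.
have S_gt0 : (0 < #|` sdiff A|)%N.
  apply: leq_trans (fsubset_leq_card BA).
  by rewrite cardfs_gt0; apply/fset0Pn; exists 0; exact: sdiff0.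
rewrite mulnDl; have [small|big] := leqP #|` B| (2 * #|` sdiff Q|).
  apply: leq_trans (leq_addr _ _); rewrite -[leqLHS]muln1.
  apply: leq_mul; last by rewrite expn_gt0 S_gt0.
  rewrite leq_exp2r ?expn_gt0 //; apply: (leq_trans small).
  rewrite leq_mul2l /=; apply: (leq_trans sQ); rewrite leq_exp2l //.
  by rewrite -iju; lia.
have [d dQ hB] := popular_difference _ _ _ B_gt0 (ltnW big) BA.
have [cQ' sQ'] := card_double _ _ Q_gt0 dQ.
set B' := [fset _ in _ | _]%fset in hB.
have B'QA : (sumset B' (sumset [fset 0%R; d] Q) `<=` A)%fset.
  apply/fsubsetP => _ /sumsetP[x [_ [xB' /sumsetP[e [q [ed qQ ->]]] ->]]].
  rewrite addrA; apply: (fsubsetP BQA); apply: mem_sumset => //.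
  by move: xB' ed; rewrite !inE /= => /andP[xB xdB] /orP[]/eqP->; rewrite ?addr0.
have := IHK A B' (sumset [fset 0%R; d]%fset Q) j.+1 iju.
rewrite cQ' cQ -expnS => /(_ erefl) IH.
have {IH} hB' : (#|` B'| ^ (2 ^ i.+1) <= K * #|` sdiff A| ^ (2 ^ i.+1).-1)%N.
  apply: IH => //; apply: (leq_trans sQ').
  by rewrite (expnS 3) leq_mul2l sQ orbT.
apply: leq_trans (leq_addl _ _).
rewrite (expnS 2 i.+1) expnM.
set e := (2 ^ i.+1)%N in hB' *.
have e_gt0 : (0 < e)%N by rewrite expn_gt0.
apply: (@leq_trans ((2 * #|` sdiff A| * #|` B'|) ^ e)); first by rewrite leq_exp2r.
(* One factor [#|sdiff A| ^ e] comes from the popular difference, the other, of exponent [e.-1],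
   from the induction hypothesis on [B']. *)
have -> : (2 * e).-1 = (e + e.-1)%N by lia.
rewrite !expnMn expnD -!mulnA leq_mul2l; apply/orP; right.
by rewrite (mulnCA K) leq_mul2l hB' orbT.
Qed.

(** * From the recursion to the asymptotic bound *)

Lemma leq_card_sdiff_self {V : zmodType} (A : {fset V}) :
  (#|` A| <= #|` sdiff A|)%N.
Proof.
have [->|[a aA]] := fset_0Vmem A; first by rewrite cardfs0.
apply: (leq_card_inj (fun x => x - a)) => [x y _ _ /addIr //|x xA].
exact: mem_sdiff.
Qed.

Lemma exp2S_pred_gt0 (u : nat) : (0 < (2 ^ u.+1).-1)%N.
Proof. by rewrite -ltnS prednK ?expn_gt0 // -[ltnLHS]/(2 ^ 0)%N ltn_exp2l. Qed.

Lemma diffset_lower_bound {R : realType} (u m : nat) :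
  exists K, forall A : {fset R}, (1 < #|` A|)%N -> no_configuration u m A ->
  (#|` A| ^ (2 ^ u.+1) <= (K * #|` diffset A|) ^ (2 ^ u.+1).-1)%N.
Proof.
have [K hK] := @cube_recursion R u m u.
(* The 3 absorbs the [+ 1] of [card_sdiff], as two points give a positive difference; [K.+1] is a
   positive base, so the constant moves inside the power. *)
exists (3 * K.+1)%N => A A_gt1 noA; have A_gt0 := ltnW A_gt1.
have := hK A A [fset 0%R]%fset 0%N (addn0 _) (cardfs1 _) _ _ noA.
have s0 : (#|` sdiff [fset (0 : R)%R]%fset| <= 3 ^ 0)%N.
  apply: (@leq_trans #|` [fset (0 : R)%R]%fset|); last by rewrite cardfs1.
  apply: fsubset_leq_card; apply/fsubsetP => _ /sdiffP[x [y [+ + ->]]].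
  by rewrite !inE => /eqP-> /eqP->; rewrite subrr.
have A0 : (sumset A [fset 0%R] `<=` A)%fset.
  apply/fsubsetP => _ /sumsetP[x [y [xA + ->]]].
  by rewrite inE => /eqP->; rewrite addr0.
move=> /(_ s0 A0) /leq_trans; apply.
have N_gt0 := exp2S_pred_gt0 u.
have sA : (#|` sdiff A| <= 3 * #|` diffset A|)%N.
  by have := leq_trans A_gt1 (leq_card_sdiff_self A); rewrite card_sdiff //; lia.
apply: (@leq_trans ((K.+1 * #|` sdiff A|) ^ (2 ^ u.+1).-1)).
  rewrite expnMn leq_mul2r; apply/orP; right.
  by rewrite (leq_trans (leqnSn K)) // -[leqLHS]expn1 leq_pexp2l.
by rewrite leq_exp2r // mulnAC mulnC leq_mul2r sA orbT.
Qed.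

(** With [k = 2 ^ u.+1 * m] the threshold is [3 ^ u * m ^ 2 + (3 ^ u + 1) / 2]; doubled, it is
    [(2 * m ^ 2 + 1) * 3 ^ u + 1]. *)
Lemma local_property_no_configuration {R : realType} (u m : nat) (A : {fset R}) :
  (0 < m)%N ->
  local_property (2 ^ u.+1 * m)
    (3 ^+ u / 4 ^+ u.+1 * (2 ^ u.+1 * m)%:R ^+ 2 + (3 ^+ u + 1) / 2) A ->
  no_configuration u m A.
Proof.
move=> m_gt0 locA A' A'A cA'.
have A'_gt0 : (0 < #|` A'|)%N by rewrite cA' muln_gt0 expn_gt0.
have := locA _ A'A cA'.
have -> : 3 ^+ u / 4 ^+ u.+1 * (2 ^ u.+1 * m)%:R ^+ 2 = 3 ^+ u * m%:R ^+ 2 :> R.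
  rewrite natrM natrX exprMn -exprM mulnC exprM.
  have -> : (2 ^+ 2 : R) = 4 by ring.
  by field; rewrite expf_neq0 // pnatr_eq0.
rewrite card_sdiff // => le_d; suff : ((2 * m ^ 2).+1 * 3 ^ u).+1%:R
    <= (2 * #|` diffset A'|)%:R :> R by rewrite ler_nat => /leqW.
rewrite -addn1 natrD natrM -addn1 natrD !natrM !natrX.
lra.
Qed.

Theorem theorem1p8 (R : realType) (t k : nat) (t_gt0 : (0 < t)%N)
    (k_gt0 : (0 < k)%N) (dvd_2t_k : (2 ^ t %| k)%N) :
  ebigOmega
    (fun n : nat => g n k (3 ^+ t.-1 / 4 ^+ t * k%:R ^+ 2
                           + (3 ^+ t.-1 + 1) / 2 : R))
    (fun n : nat => n%:R `^ (1 + 1 / (2 ^+ t - 1))).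
Proof.
case: t t_gt0 dvd_2t_k => // u _ /dvdnP[m]; rewrite mulnC => k_eq.
move: k_gt0; rewrite k_eq muln_gt0 => /andP[_ m_gt0] {k k_eq} /=.
have [K hK] := @diffset_lower_bound R u m.
have N_gt0 := exp2S_pred_gt0 u.
exists (K.+1%:R^-1); first by rewrite invr_gt0.
near=> n; apply: le_ereal_inf_tmp => _ [A [cA locA] <-].
have n_gt1 : (1 < n)%N by near: n; exact: nbhs_infty_gt.
rewrite lee_fin mulrC ler_pdivrMr //.
have noA := local_property_no_configuration _ _ _ m_gt0 locA.
have {}hK := hK A; rewrite cA in hK; have {}hK := hK n_gt1 noA.
have N1 : ((2 ^ u.+1).-1%:R : R) = 2 ^+ u.+1 - 1.
  by rewrite -subn1 natrB ?expn_gt0 // natrX.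
have N_neq0 : (2 ^+ u.+1 - 1 : R) != 0 by rewrite -N1 pnatr_eq0 -lt0n.
(* Raising to the power [2 ^ u.+1 - 1] turns the real exponent into the natural number
   [2 ^ u.+1]. *)
rewrite -(@ler_pXn2r _ (2 ^ u.+1).-1) ?nnegrE ?powR_ge0 ?mulr_ge0 //.
rewrite -powR_mulrn ?powR_ge0 // -powRrM N1.
have -> : (1 + 1 / (2 ^+ u.+1 - 1)) * (2 ^+ u.+1 - 1) = (2 ^ u.+1)%:R :> R.
  by rewrite natrX; field.
rewrite powR_mulrn // -!natrM -!natrX ler_nat.
apply: (leq_trans hK); rewrite leq_exp2r //.
by rewrite mulnC leq_mul2l leqnSn orbT.
Unshelve. all: by end_near.
Qed.
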